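(* Let $E\colon V\to\overline{\mathbb{R}}$ be proper, convex, lower semicontinuous, and coercive on a real Hilbert space $V$, let $V=\sum_{j=1}^J\Pi_jV_j$ be a space decomposition with real Hilbert spaces $V_j$ and bounded linear operators $\Pi_j\colon V_j\to V$, and let $\underset{\sim}{V}=\prod_{j=1}^JV_j$ and $\Pi\colon\underset{\sim}{V}\to V$, $\Pi\underset{\sim}{v}=\sum_{j=1}^J\Pi_jv_j$, where $\underset{\sim}{v}=(v_1,\dots,v_J)$. Here $\underset{\sim}{V}$, $\underset{\sim}{v}$, etc. denote the product space and its elements. Let $E_j(\cdot\,;v)$ ($v\in V$) be the local models for subspace correction and $\underset{\sim}{E}_j(\cdot\,;\underset{\sim}{v})$ ($\underset{\sim}{v}\in\underset{\sim}{V}$) the local block models for the expanded problem, all with unique minimizers over $V_j$. Suppose that the local models satisfy $$E_j(w_j;\Pi\underset{\sim}{v}^{\mathrm{old}})=\underset{\sim}{E}_j(v_j^{\mathrm{old}}+w_j;\underset{\sim}{v}^{\mathrm{old}}),\quad w_j\in V_j,\ \underset{\sim}{v}^{\mathrm{old}}\in\underset{\sim}{V},\ 1\le j\le J.$$ Then the parallel subspace correction method (PSC) is equivalent to the expanded Jacobi method (with the same parameter $\tau>0$), and the successive subspace correction method (SSC) is equivalent to the expanded Gauss--Seidel method. More precisely, in each of the two cases, if $u^{(0)}=\Pi\underset{\sim}{u}^{(0)}$, then the corresponding iterates satisfy $$u^{(n)}=\Pi\underset{\sim}{u}^{(n)},\quad n\geq 1.$$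
   Context: The problem is $\min_{v\in V}E(v)$; the expanded problem is $\min_{\underset{\sim}{v}\in\underset{\sim}{V}}\underset{\sim}{E}(\underset{\sim}{v})$ with $\underset{\sim}{E}(\underset{\sim}{v})=E(\Pi\underset{\sim}{v})$. The under-tilde is only a notation for objects on the product space. Local models: $E_j(w_j;u^{\mathrm{old}})$, $w_j\in V_j$, $u^{\mathrm{old}}\in V$, is an (extended real-valued) approximation of $E(u^{\mathrm{old}}+\Pi_jw_j)$; it is assumed that $\min_{w_j\in V_j}E_j(w_j;u^{\mathrm{old}})$ has a unique solution for every $u^{\mathrm{old}}\in V$. Similarly, $\underset{\sim}{E}_j(v_j;\underset{\sim}{v}^{\mathrm{old}})$, $v_j\in V_j$, is an approximation of $\underset{\sim}{E}(v_1^{\mathrm{old}},\dots,v_{j-1}^{\mathrm{old}},v_j,v_{j+1}^{\mathrm{old}},\dots,v_J^{\mathrm{old}})$ with a unique minimizer over $v_j\in V_j$. PSC: given $\tau>0$ and $u^{(0)}\in V$, for $n=0,1,2,\dots$: for each $1\le j\le J$ let $w_j^{(n+1)}\in\arg\min_{w_j\in V_j}E_j(w_j;u^{(n)})$; then $u^{(n+1)}=u^{(n)}+\tau\sum_{j=1}^J\Pi_jw_j^{(n+1)}$. SSC: given $u^{(0)}\in V$, for $n=0,1,2,\dots$ and $j=1,\dots,J$ successively: $w_j^{(n+1)}\in\arg\min_{w_j\in V_j}E_j(w_j;u^{(n+\frac{j-1}{J})})$, $u^{(n+\frac{j}{J})}=u^{(n+\frac{j-1}{J})}+\Pi_jw_j^{(n+1)}$.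 Expanded Jacobi: given $\tau>0$ and $\underset{\sim}{u}^{(0)}\in\underset{\sim}{V}$, for $n=0,1,2,\dots$: for each $1\le j\le J$ let $\hat{u}_j^{(n+1)}\in\arg\min_{v_j\in V_j}\underset{\sim}{E}_j(v_j;\underset{\sim}{u}^{(n)})$; then, with $\hat{\underset{\sim}{u}}^{(n+1)}=(\hat{u}_1^{(n+1)},\dots,\hat{u}_J^{(n+1)})$, set $\underset{\sim}{u}^{(n+1)}=(1-\tau)\underset{\sim}{u}^{(n)}+\tau\hat{\underset{\sim}{u}}^{(n+1)}$. Expanded Gauss--Seidel: given $\underset{\sim}{u}^{(0)}\in\underset{\sim}{V}$, for $n=0,1,2,\dots$ and $j=1,\dots,J$ successively: $u_j^{(n+1)}\in\arg\min_{v_j\in V_j}\underset{\sim}{E}_j\big(v_j;(u_1^{(n+1)},\dots,u_{j-1}^{(n+1)},u_j^{(n)},\dots,u_J^{(n)})\big)$; $\underset{\sim}{u}^{(n)}=(u_1^{(n)},\dots,u_J^{(n)})$. *)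

(* Defs.v *)
From HB Require Import structures.
From mathcomp Require Import all_boot all_order all_algebra.
From mathcomp Require Import all_classical all_reals all_analysis.
Import Order.TTheory GRing.Theory Num.Theory.
Import numFieldNormedType.Exports.

Set Implicit Arguments.
Unset Strict Implicit.
Unset Printing Implicit Defensive.

Local Open Scope classical_set_scope.
Local Open Scope ring_scope.

HB.mixin Record CompleteNormedModule_isHilbert (R : realType) V
    of CompleteNormedModule R V := {
  inner : {dot V for idfun} ;
  inner_normE : forall x : V, inner x x = `|x| ^+ 2
}.

#[short(type="hilbertType")]
HB.structure Definition Hilbert (R : realType) :=
  {V of CompleteNormedModule_isHilbert R V & CompleteNormedModule R V}.

(* Alias, so that the componentwise vector space structure below is attached
   to the product of the family and not to every dependent function type. *)
Definition prodspace (R : realType) (J : nat) (V_ : 'I_J -> hilbertType R) :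
  Type := forall j : 'I_J, V_ j.

Section prodspace_lmodType.
Context {R : realType} {J : nat} (V_ : 'I_J -> hilbertType R).
Implicit Types (u v w : prodspace V_) (a b : R).

HB.instance Definition _ := gen_eqMixin (prodspace V_).
HB.instance Definition _ := gen_choiceMixin (prodspace V_).

Let zero : prodspace V_ := fun=> 0.
Let opp u : prodspace V_ := fun j => - u j.
Let add u v : prodspace V_ := fun j => u j + v j.
Let scale a u : prodspace V_ := fun j => a *: u j.

Let addA : associative add.
Proof. by move=> u v w; apply: functional_extensionality_dep => j; rewrite /add addrA. Qed.

Let addC : commutative add.
Proof. by move=> u v; apply: functional_extensionality_dep => j; rewrite /add addrC. Qed.

Let add0 : left_id zero add.
Proof. by move=> u; apply: functional_extensionality_dep => j; rewrite /add add0r. Qed.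

Let addN : left_inverse zero opp add.
Proof. by move=> u; apply: functional_extensionality_dep => j; rewrite /add addNr. Qed.

HB.instance Definition _ :=
  GRing.isZmodule.Build (prodspace V_) addA addC add0 addN.

Let scaleA a b v : scale a (scale b v) = scale (a * b) v.
Proof. by apply: functional_extensionality_dep => j; rewrite /scale scalerA. Qed.

Let scale1 : left_id 1 scale.
Proof. by move=> u; apply: functional_extensionality_dep => j; rewrite /scale scale1r. Qed.

Let scaleDr : right_distributive scale +%R.
Proof. by move=> a u v; apply: functional_extensionality_dep => j; exact: scalerDr. Qed.

Let scaleDl v : {morph scale^~ v : a b / a + b}.
Proof. by move=> a b; apply: functional_extensionality_dep => j; exact: scalerDl. Qed.

HB.instance Definition _ := GRing.Zmodule_isLmodule.Build R (prodspace V_)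
  scaleA scale1 scaleDr scaleDl.

Lemma prodspace_addE u v j : (u + v) j = u j + v j.
Proof. by []. Qed.

Lemma prodspace_scaleE a u j : (a *: u) j = a *: u j.
Proof. by []. Qed.

End prodspace_lmodType.

Section functionals.
Context {R : realType}.

Section on_types.
Context {T : Type}.
Implicit Type f : T -> \bar R.

Definition argmin f : set T := [set x | forall y, (f x <= f y)%E].

Definition unique_argmin f := exists! x, argmin f x.

Definition proper_fun f :=
  (forall x, f x != -oo%E) /\ (exists x, f x != +oo%E).

End on_types.

(* Only meaningful for functions that do not take the value -oo (in
   particular proper ones), since -oo + +oo = -oo in \bar R. At the end points
   the term with coefficient 0 vanishes, as 0 * +oo = 0 in \bar R. *)
Definition convex_fun (V : lmodType R) (f : V -> \bar R) :=
  forall (x y : V) (t : R), 0 <= t <= 1 ->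
    (f (t *: x + (1 - t) *: y)%R <= t%:E * f x + (1 - t)%:E * f y)%E.

Definition coercive_fun (V : normedModType R) (f : V -> \bar R) :=
  forall A : R, exists r : R, forall x : V, r <= `|x| -> (A%:E <= f x)%E.

Definition bounded_operator (U V : normedModType R) (f : U -> V) :=
  exists M : R, forall x : U, `|f x| <= M * `|x|.

End functionals.

Section subspace_correction.
Context {R : realType} {J : nat} {V : hilbertType R}.
Context {V_ : 'I_J -> hilbertType R}.
Variable P_ : forall j : 'I_J, {linear V_ j -> V}.

Definition sumop (v : prodspace V_) : V := \sum_(j < J) P_ j (v j).

Definition space_decomposition :=
  forall v : V, exists w : prodspace V_, v = \sum_(j < J) P_ j (w j).

Variable E_ : forall j : 'I_J, V_ j -> V -> \bar R.

Definition psc (tau : R) (u : nat -> V) := forall n, exists w : prodspace V_,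
  (forall j, argmin (fun wj => E_ wj (u n)) (w j)) /\
  u n.+1 = u n + tau *: \sum_(j < J) P_ j (w j).

(* [s j] is the fractional iterate u^(n + j/J). The block with ordinal index
   [j : 'I_J] is the (j+1)-st one in the usual numbering from 1 to J. *)
Definition ssc (u : nat -> V) := forall n, exists s : nat -> V,
  [/\ s 0%N = u n,
      (forall j : 'I_J, exists2 w : V_ j,
         argmin (fun wj => E_ wj (s j)) w & s j.+1 = s j + P_ j w) &
      u n.+1 = s J].

End subspace_correction.

Section expanded_methods.
Context {R : realType} {J : nat} {V_ : 'I_J -> hilbertType R}.
Variable F_ : forall j : 'I_J, V_ j -> prodspace V_ -> \bar R.

Definition jacobi (tau : R) (u : nat -> prodspace V_) :=
  forall n, exists uhat : prodspace V_,
  (forall j, argmin (fun vj => F_ vj (u n)) (uhat j)) /\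
  u n.+1 = (1 - tau) *: u n + tau *: uhat.

Definition gs_mix (j : 'I_J) (unew uold : prodspace V_) : prodspace V_ :=
  fun i => if (i < j)%N then unew i else uold i.

Definition gauss_seidel (u : nat -> prodspace V_) := forall n (j : 'I_J),
  argmin (fun vj : V_ j => F_ vj (gs_mix j (u n.+1) (u n))) (u n.+1 j).

End expanded_methods.

(* Main.v *)
Require Import Defs.
From mathcomp Require Import all_boot all_order all_algebra.
From mathcomp Require Import all_classical all_reals all_analysis.
Import Order.TTheory GRing.Theory Num.Theory.
Import numFieldNormedType.Exports.

Local Open Scope classical_set_scope.
Local Open Scope ring_scope.

(** The equivalence of the two pairs of methods rests on the change of variable
    [v_j = vold_j + w_j] in the [j]-th local problem.  By the compatibility of
    the local models, the translation by [vold_j] carries the subspace problem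
    at [sumop P_ vold] to the block problem at [vold]; hence it carries
    minimizers to minimizers, and since the subspace minimizer is unique, the
    subspace correction is exactly the increment of the block
    ([correction_eq_block_increment]).

    Everything else is linearity of [sumop P_].  A relaxed Jacobi step moves the
    product-space iterate by [tau] times the vector of block increments, so its
    image under [sumop P_] moves by the parallel correction
    ([psc_jacobi_step]).  Within a Gauss-Seidel sweep, passing from
    block [j] to the next replaces a single component, so the image of the
    partially updated vector moves by [P_ j] of that component's increment: the
    fractional iterates of the successive method are the images of the
    partially updated vectors, by induction along the sweep
    ([ssc_gauss_seidel_sweep]).  Induction on the outer iteration
    concludes in both cases. *)

Section block_increments.
Set Implicit Arguments.
Unset Strict Implicit.
Context {R : realType} {J : nat} {V : hilbertType R}.
Context {V_ : 'I_J -> hilbertType R}.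
Context (P_ : forall j : 'I_J, {linear V_ j -> V}).

Lemma sumopD (x y : prodspace V_) : sumop P_ (x + y) = sumop P_ x + sumop P_ y.
Proof.
rewrite /sumop -big_split; apply: eq_bigr => j _.
by rewrite prodspace_addE linearD.
Qed.

Lemma sumopZ (a : R) (x : prodspace V_) : sumop P_ (a *: x) = a *: sumop P_ x.
Proof.
rewrite /sumop scaler_sumr; apply: eq_bigr => j _.
by rewrite prodspace_scaleE linearZ.
Qed.

(** [gs_mix] with the cut at an arbitrary natural number: cutting at [J] gives
    the state after the last block of a sweep, which no [j : 'I_J] indexes. *)
Definition partial_update (k : nat) (vnew vold : prodspace V_) : prodspace V_ :=
  fun i => if (i < k)%N then vnew i else vold i.

Lemma partial_update0 (vnew vold : prodspace V_) :
  partial_update 0 vnew vold = vold.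
Proof. exact: functional_extensionality_dep. Qed.

Lemma partial_update_full (vnew vold : prodspace V_) :
  partial_update J vnew vold = vnew.
Proof.
by apply: functional_extensionality_dep => i; rewrite /partial_update ltn_ord.
Qed.

Lemma sumop_partial_updateS (j : 'I_J) (vnew vold : prodspace V_) :
  sumop P_ (partial_update j.+1 vnew vold) =
  sumop P_ (partial_update j vnew vold) + P_ j (vnew j - vold j).
Proof.
rewrite /sumop (bigD1 j) //= [X in _ = X + _](bigD1 j) //=.
rewrite /partial_update ltnSn ltnn [RHS]addrAC linearB subrKC.
congr (_ + _); apply: eq_bigr => i i_neq_j.
by rewrite ltnS leq_eqVlt val_eqE (negbTE i_neq_j).
Qed.

Context (E_ : forall j : 'I_J, V_ j -> V -> \bar R).
Context (F_ : forall j : 'I_J, V_ j -> prodspace V_ -> \bar R).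
Context (E_min : forall (j : 'I_J) (uold : V),
  unique_argmin (fun wj : V_ j => E_ wj uold)).
Context (EF : forall (j : 'I_J) (wj : V_ j) (vold : prodspace V_),
  E_ wj (sumop P_ vold) = F_ (vold j + wj) vold).

(** The local problems at [sumop P_ vold] and at [vold] are translates of each
    other, so the increment [vj - vold j] also minimizes the former, and there
    is only one such minimizer. *)
Lemma correction_eq_block_increment (j : 'I_J) (vold : prodspace V_)
    (wj vj : V_ j) :
  argmin (fun w => E_ w (sumop P_ vold)) wj ->
  argmin (fun v => F_ v vold) vj ->
  wj = vj - vold j.
Proof.
move=> wj_min vj_min; have [w0 [_ w0_uniq]] := E_min j (sumop P_ vold).
rewrite -(w0_uniq _ wj_min); apply: w0_uniq => y.
by rewrite !EF subrKC; exact: vj_min.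
Qed.

Lemma psc_jacobi_step (tau : R) (vold vhat w : prodspace V_) :
  (forall j, argmin (fun wj => E_ wj (sumop P_ vold)) (w j)) ->
  (forall j, argmin (fun vj => F_ vj vold) (vhat j)) ->
  sumop P_ vold + tau *: \sum_(j < J) P_ j (w j) =
  sumop P_ ((1 - tau) *: vold + tau *: vhat).
Proof.
move=> w_min vhat_min.
have -> : vhat = vold + w.
  apply: functional_extensionality_dep => j; rewrite prodspace_addE.
  rewrite (correction_eq_block_increment (w_min j) (vhat_min j)).
  by rewrite subrKC.
rewrite scalerDr addrA -scalerDl subrK scale1r.
by rewrite sumopD sumopZ.
Qed.

(** The invariant of a sweep.  Since [partial_update j] leaves component [j]
    untouched, the block problem at stage [j] is translated by [vold j], so that
    the correction there is the full increment [vnew j - vold j]. *)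
Lemma ssc_gauss_seidel_sweep (s : nat -> V) (vold vnew : prodspace V_) :
  s 0%N = sumop P_ vold ->
  (forall j : 'I_J, exists2 w : V_ j,
     argmin (fun wj => E_ wj (s j)) w & s j.+1 = s j + P_ j w) ->
  (forall j : 'I_J,
     argmin (fun vj : V_ j => F_ vj (gs_mix j vnew vold)) (vnew j)) ->
  forall k : nat, (k <= J)%N -> s k = sumop P_ (partial_update k vnew vold).
Proof.
move=> s0 s_step vnew_min; elim=> [_|k IHk k_lt_J].
  by rewrite partial_update0.
pose j := Ordinal k_lt_J.
have sk := IHk (ltnW k_lt_J).
have [w w_min sS] := s_step j; rewrite [LHS]sS /= sk.
rewrite [RHS](sumop_partial_updateS j); congr (_ + P_ j _).
rewrite /= sk in w_min.
rewrite (correction_eq_block_increment w_min (vnew_min j)).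
by rewrite /partial_update ltnn.
Qed.

End block_increments.

Theorem theorem4p6 (R : realType) (J : nat) (J_gt0 : (0 < J)%N)
    (V : hilbertType R) (V_ : 'I_J -> hilbertType R)
    (P_ : forall j : 'I_J, {linear V_ j -> V})
    (P_bounded : forall j : 'I_J, bounded_operator (P_ j))
    (decV : space_decomposition P_)
    (E : V -> \bar R)
    (E_proper : proper_fun E) (E_convex : convex_fun E)
    (E_lsc : lower_semicontinuous E) (E_coercive : coercive_fun E)
    (E_ : forall j : 'I_J, V_ j -> V -> \bar R)
    (E_min : forall (j : 'I_J) (uold : V),
       unique_argmin (fun wj : V_ j => E_ j wj uold))
    (F_ : forall j : 'I_J, V_ j -> prodspace V_ -> \bar R)
    (F_min : forall (j : 'I_J) (vold : prodspace V_),
       unique_argmin (fun vj : V_ j => F_ j vj vold))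
    (EF : forall (j : 'I_J) (wj : V_ j) (vold : prodspace V_),
       E_ j wj (sumop P_ vold) = F_ j (vold j + wj) vold) :
  (forall (tau : R), 0 < tau ->
     forall (u : nat -> V) (uu : nat -> prodspace V_),
     psc P_ E_ tau u -> jacobi F_ tau uu ->
     u 0%N = sumop P_ (uu 0%N) ->
     forall n : nat, (1 <= n)%N -> u n = sumop P_ (uu n)) /\
  (forall (u : nat -> V) (uu : nat -> prodspace V_),
     ssc P_ E_ u -> gauss_seidel F_ uu ->
     u 0%N = sumop P_ (uu 0%N) ->
     forall n : nat, (1 <= n)%N -> u n = sumop P_ (uu n)).
Proof.
split=> [tau _ u uu u_psc uu_jac u0 n _|u uu u_ssc uu_gs u0 n _].
  elim: n => [//|n IHn].
  have [w [w_min ->]] := u_psc n; have [vhat [vhat_min ->]] := uu_jac n.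
  rewrite IHn; apply: (psc_jacobi_step E_min EF) vhat_min.
  by rewrite -IHn.
elim: n => [//|n IHn].
have [s [s0 s_step ->]] := u_ssc n.
rewrite -[uu n.+1](partial_update_full (uu n.+1) (uu n)).
rewrite IHn in s0.
exact: (ssc_gauss_seidel_sweep E_min EF s0 s_step (uu_gs n) (leqnn J)).
Qed.
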